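(* For every $m\ge 1$ and any cochain $c\in C^m$ the following multiplicative identity holds: $$\bigl(d^{m-1}h^{m}c\bigr)(g_1,\dots,g_m;\boldsymbol{x})\cdot\bigl(h^{m+1}d^{m}c\bigr)(g_1,\dots,g_m;\boldsymbol{x})=c(g_1,\dots,g_m;\boldsymbol{x}).$$
   Context: Fix $n\ge3$. Let $\mathcal{M}=(J^1(\mathbb{R}^2,\mathbb{R}))^n\cong(\mathbb{R}^2\times\mathbb{R}^2)^n$ be the $n$-fold first-order jet space, with coordinates $\boldsymbol{x}=(x_i,y_i,p_i,q_i)_{i=1}^n$, where $p_i=\partial_xu(x_i,y_i)$ and $q_i=\partial_yu(x_i,y_i)$ for a smooth function $u:\mathbb{R}^2\to\mathbb{R}$. The group $G=PGL(3,\mathbb{R})$ acts on $\mathcal{M}$, $(g,\boldsymbol{x})\mapsto g\cdot\boldsymbol{x}$, with $g_1\cdot(g_2\cdot\boldsymbol{x})=(g_1g_2)\cdot\boldsymbol{x}$: for $g$ represented by the matrix with rows $(a_1,a_2,a_3)$, $(b_1,b_2,b_3)$, $(c_1,c_2,c_3)$, normalized by $c_3=1$, each point is transformed by $$\widetilde x_i=\frac{a_1x_i+a_2y_i+a_3}{c_1x_i+c_2y_i+1},\qquad \widetilde y_i=\frac{b_1x_i+b_2y_i+b_3}{c_1x_i+c_2y_i+1},$$ and the derivatives $(p_i,q_i)$ are transformed by the first prolongation, i.e. $p_i=\widetilde p_i\,\partial_x\widetilde x+\widetilde q_i\,\partial_x\widetilde y$, $q_i=\widetilde p_i\,\partial_y\widetilde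 x+\widetilde q_i\,\partial_y\widetilde y$, with the partial derivatives of the projective map evaluated at $(x_i,y_i)$. Moving frame: $\rho:\mathcal{M}\to G$ is the global right moving frame, $\rho(g\cdot\boldsymbol{x})=\rho(\boldsymbol{x})g^{-1}$, obtained by solving $\rho(\boldsymbol{x})\cdot\boldsymbol{x}\in\mathcal{K}$ for the cross-section $\mathcal{K}=\{x_1=1,\ x_2=0,\ x_3=0,\ y_1=0,\ y_2=0,\ y_3=1,\ p_1=1,\ q_1=0\}$. Cochains: let $\mathbb{R}^\times=\mathbb{R}\setminus\{0\}$, and let $M^\times=\operatorname{Map}(\mathcal{M},\mathbb{R}^\times)$ be the multiplicative abelian group (under pointwise multiplication) of all nonzero rational functions on $\mathcal{M}$. The multiplicative cochain complex with coefficients in $M^\times$ has $C^m=\operatorname{Map}(G^m\times\mathcal{M},\mathbb{R}^\times)$ for $m\ge0$ (so $C^0=M^\times$), with differentials $d^m:C^m\to C^{m+1}$ given by $(d^0c)(g,\boldsymbol{x})=c(g\cdot\boldsymbol{x})/c(\boldsymbol{x})$ and, for $m\ge1$, $$(d^mc)(g_1,\dots,g_{m+1};\boldsymbol{x})=c(g_2,\dots,g_{m+1};\boldsymbol{x})\cdot\prod_{i=1}^m c(g_1,\dots,g_ig_{i+1},\dots,g_{m+1};\boldsymbol{x})^{(-1)^i}\cdot c(g_1,\dots,g_m;g_{m+1}\cdot\boldsymbol{x})^{(-1)^{m+1}}.$$ Homotopy operators: for each $m\ge1$ the operator $h^m:C^m\to C^{m-1}$ is defined by $$(h^mc)(g_1,\dots,g_{m-1};\boldsymbol{x})=c\bigl(\rho(g_1\cdots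 g_{m-1}\cdot\boldsymbol{x}),\,g_1,\dots,g_{m-1};\,\boldsymbol{x}\bigr),\qquad c\in C^m$$ (for $m=1$ the product $g_1\cdots g_{m-1}$ is empty, so $(h^1c)(\boldsymbol{x})=c(\rho(\boldsymbol{x});\boldsymbol{x})$).
   Formalization: For m=1 the identity fails with the printed d^0c=c(g·x)/c(x) (e.g. c=x_1 gives 4, not 1, at x in K, g=diag(2,1,1)); d^0c is taken as c(x)/c(g·x), the general formula at m=0. The identity is asserted wherever d^{m-1}h^mc is defined and nonzero. *)

(* Defs.v *)
From HB Require Import structures.
From mathcomp Require Import all_boot all_order all_algebra.
From mathcomp Require Import generic_quotient.
From mathcomp Require Import all_classical all_reals all_analysis.
(* The notations of mpoly clash with those of MathComp-Analysis. *)
From mathcomp Require Import (canonicals) mpoly.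
Set Implicit Arguments.
Unset Strict Implicit.
Unset Printing Implicit Defensive.
Import Order.TTheory GRing.Theory Num.Theory.
Import numFieldNormedType.Exports.
Local Open Scope quotient_scope.
Local Open Scope ring_scope.

Definition GL3 (R : realType) := {A : 'M[R]_3 | A \in unitmx}.
HB.instance Definition _ (R : realType) := SubChoice.on (GL3 R).

Section PGL3.
Variable R : realType.
Implicit Types A B C : GL3 R.

Lemma gl3_mul_subproof A B : val A *m val B \in unitmx.
Proof. by rewrite unitmx_mul (valP A); exact: valP B. Qed.
Lemma gl3_inv_subproof A : invmx (val A) \in unitmx.
Proof. by rewrite unitmx_inv; exact: valP A. Qed.
Definition gl3_mul A B : GL3 R := Sub (val A *m val B) (gl3_mul_subproof A B).
Definition gl3_inv A : GL3 R := Sub (invmx (val A)) (gl3_inv_subproof A).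
Definition gl3_one : GL3 R := Sub 1%:M (unitmx1 R 3).

Definition gl3_prop A B : bool :=
  `[< exists2 k : R, k != 0 & val A = k *: val B >].

Lemma gl3_prop_refl : reflexive gl3_prop.
Proof. by move=> A; apply/asboolP; exists 1; rewrite ?oner_neq0 ?scale1r. Qed.

Lemma gl3_prop_sym : symmetric gl3_prop.
Proof.
by move=> A B; apply/asboolP/asboolP => -[k k0 e];
  exists k^-1; rewrite ?invr_eq0 // e scalerA mulVf ?scale1r.
Qed.

Lemma gl3_prop_trans : transitive gl3_prop.
Proof.
move=> B A C /asboolP[k k0 eA] /asboolP[l l0 eB]; apply/asboolP.
by exists (k * l); rewrite ?mulf_neq0 // eA eB scalerA.
Qed.

Canonical gl3_prop_equiv :=
  EquivRel gl3_prop gl3_prop_refl gl3_prop_sym gl3_prop_trans.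

Definition PGL3 := {eq_quot gl3_prop_equiv}.
HB.instance Definition _ := Choice.on PGL3.
HB.instance Definition _ := EqQuotient.on PGL3.

Definition pgl3 A : PGL3 := \pi_PGL3 A.
Definition pgl3_mul (g h : PGL3) : PGL3 := pgl3 (gl3_mul (repr g) (repr h)).
Definition pgl3_inv (g : PGL3) : PGL3 := pgl3 (gl3_inv (repr g)).
Definition pgl3_one : PGL3 := pgl3 gl3_one.

Lemma pgl3_eqP A B :
  (exists2 k : R, k != 0 & val A = k *: val B) <-> pgl3 A = pgl3 B.
Proof.
split=> [AB|/eqmodP/asboolP//]; by apply/eqmodP/asboolP.
Qed.

Lemma repr_pgl3 A :
  exists2 k : R, k != 0 & val (repr (pgl3 A)) = k *: val A.
Proof. by apply/pgl3_eqP; rewrite /pgl3 reprK. Qed.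

Lemma pgl3M A B : pgl3_mul (pgl3 A) (pgl3 B) = pgl3 (gl3_mul A B).
Proof.
apply/pgl3_eqP; have [k k0 eA] := repr_pgl3 A; have [l l0 eB] := repr_pgl3 B.
exists (k * l); first by rewrite mulf_neq0.
by rewrite /= eA eB -scalemxAl -scalemxAr scalerA.
Qed.

Lemma pgl3V A : pgl3_inv (pgl3 A) = pgl3 (gl3_inv A).
Proof.
apply/pgl3_eqP; have [k k0 eA] := repr_pgl3 A.
exists k^-1; first by rewrite invr_eq0.
by rewrite /= eA invmxZ // -eA; exact: valP (repr _).
Qed.

Lemma pgl3W (P : PGL3 -> Prop) : (forall A, P (pgl3 A)) -> forall g, P g.
Proof. by move=> PA g; rewrite -[g]reprK; apply: PA. Qed.

Lemma pgl3_mulA : associative pgl3_mul.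
Proof.
elim/pgl3W=> A; elim/pgl3W=> B; elim/pgl3W=> C; rewrite !pgl3M.
by congr pgl3; apply: val_inj; rewrite /= mulmxA.
Qed.

Lemma pgl3_mul1 : left_id pgl3_one pgl3_mul.
Proof.
elim/pgl3W=> A; rewrite pgl3M.
by congr pgl3; apply: val_inj; rewrite /= mul1mx.
Qed.

Lemma pgl3_mulr1 : right_id pgl3_one pgl3_mul.
Proof.
elim/pgl3W=> A; rewrite pgl3M.
by congr pgl3; apply: val_inj; rewrite /= mulmx1.
Qed.

Lemma pgl3_mulV : left_inverse pgl3_one pgl3_inv pgl3_mul.
Proof.
elim/pgl3W=> A; rewrite pgl3V pgl3M.
by congr pgl3; apply: val_inj; rewrite /= mulVmx //; exact: valP A.
Qed.

Lemma pgl3_mulrV : right_inverse pgl3_one pgl3_inv pgl3_mul.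
Proof.
elim/pgl3W=> A; rewrite pgl3V pgl3M.
by congr pgl3; apply: val_inj; rewrite /= mulmxV //; exact: valP A.
Qed.

HB.instance Definition _ := isGroup.Build PGL3
  pgl3_mulA pgl3_mul1 pgl3_mulr1 pgl3_mulV pgl3_mulrV.

End PGL3.

Arguments pgl3 {R} A.
Arguments pgl3_mul {R} g h.
Arguments pgl3_inv {R} g.
Arguments pgl3_one {R}.

Section Action.
Variables (R : realType) (n : nat).

(* Row i of a jet is (x_i, y_i, p_i, q_i). *)
Definition jet := 'M[R]_(n, 4).
Definition jx (z : jet) i := z i 0.
Definition jy (z : jet) i := z i 1.
Definition jp (z : jet) i := z i 2.
Definition jq (z : jet) i := z i 3.

(* For A with rows a, b, c the projective map is written with the homogeneous
   denominator c_1 x + c_2 y + c_3; it depends on A only up to scaling and is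
   the usual formula when c_3 = 1. *)
Section Map.
Variable A : 'M[R]_3.
Definition pden (x y : R) := A 2 0 * x + A 2 1 * y + A 2 2.
Definition projx (x y : R) := (A 0 0 * x + A 0 1 * y + A 0 2) / pden x y.
Definition projy (x y : R) := (A 1 0 * x + A 1 1 * y + A 1 2) / pden x y.

Definition proj_jacobian (x y : R) : 'M[R]_2 := \matrix_(i, j)
  let f := if i == 0 then projx else projy in
  if j == 0 then derive1 (fun t => f t y) x else derive1 (fun t => f x t) y.

(* The unique solution (p', q') of
     p = p' * d_x x' + q' * d_x y',  q = p' * d_y x' + q' * d_y y'. *)
Definition prolong (x y p q : R) : 'rV[R]_2 :=
  (\row_j (if j == 0 then p else q)) *m invmx (proj_jacobian x y).
End Map.

(* The action is partial: it is defined at [z] when [act_def g z] holds,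
   elsewhere [act g z] is meaningless. *)
Definition act_def (g : PGL3 R) (z : jet) : Prop :=
  forall i, pden (val (repr g)) (jx z i) (jy z i) != 0.

Definition act (g : PGL3 R) (z : jet) : jet :=
  let A := val (repr g) in
  \matrix_(i, j)
    let x := jx z i in let y := jy z i in
    let p := jp z i in let q := jq z i in
    if j == 0 then projx A x y
    else if j == 1 then projy A x y
    else if j == 2 then prolong A x y p q 0 0
    else prolong A x y p q 0 1.

(* Points are numbered from 0, and n >= 3 is required where the frame is used. *)
Definition cross_section (z : jet) : Prop := forall i : 'I_n,
  [/\ i = 0%N :> nat -> [/\ jx z i = 1, jy z i = 0, jp z i = 1 & jq z i = 0],
      i = 1%N :> nat -> jx z i = 0 /\ jy z i = 0 &
      i = 2%N :> nat -> jx z i = 0 /\ jy z i = 1].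

Definition normalizes (z : jet) (g : PGL3 R) : Prop :=
  act_def g z /\ cross_section (act g z).

(* The moving frame is the solution g of the normalization equations; it is
   defined on [frame_def] only. *)
Definition frame_def (z : jet) : Prop := exists g, normalizes z g.
Definition rho (z : jet) : PGL3 R := xget 1%g (normalizes z).

(* Partial functions G^m x M -> R^x are encoded as R-valued functions, the
   value 0 meaning "undefined, or not in R^x". As x^-1 = 0 for x = 0, a product
   of integer powers is 0 as soon as one of the factors is undefined. *)
Definition pfun (m : nat) := ('I_m -> PGL3 R) -> jet -> R.

Definition coords m (A : 'I_m -> 'M[R]_3) (z : jet) :
    'I_(m * (3 * 3) + n * 4) -> R :=
  row_mx (mxvec (\matrix_(i < m) mxvec (A i))) (mxvec z) 0.

(* A rational function P/Q in the entries of representing matrices and in the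
   jet coordinates; that the quotient is invariant under rescaling each matrix
   is forced by the equation holding for all representatives. *)
Definition cochain m (c : pfun m) : Prop :=
  exists P Q : mpoly.mpoly (m * (3 * 3) + n * 4) R, [/\ P != 0, Q != 0 &
    forall (A : 'I_m -> GL3 R) (z : jet),
      let v := coords (fun i => val (A i)) z in
      c (fun i => pgl3 (A i)) z = mpoly.meval v P / mpoly.meval v Q].

Definition at_act m (c : pfun m) (h : PGL3 R) : pfun m := fun g z =>
  if `[< act_def h z >] then c g (act h z) else 0.

Definition omit_first m (g : 'I_m.+1 -> PGL3 R) : 'I_m -> PGL3 R :=
  fun j => g (lift ord0 j).
Definition omit_last m (g : 'I_m.+1 -> PGL3 R) : 'I_m -> PGL3 R :=
  fun j => g (lift ord_max j).
Definition prepend m (h : PGL3 R) (g : 'I_m -> PGL3 R) : 'I_m.+1 -> PGL3 R :=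
  fun j => if unlift ord0 j is Some k then g k else h.

(* With 0-based indices, (g_0, .., g_i * g_i.+1, .., g_m). *)
Definition contract m (i : 'I_m) (g : 'I_m.+1 -> PGL3 R) : 'I_m -> PGL3 R :=
  fun j => if (j < i)%N then g (lift ord_max j)
           else if j == i then (g (lift ord_max j) * g (lift ord0 j))%g
           else g (lift ord0 j).

Definition cobd m (c : pfun m) : pfun m.+1 := fun g z =>
  c (omit_first g) z
  * \prod_(i < m) c (contract i g) z ^ ((-1) ^+ i.+1)
  * at_act c (g ord_max) (omit_last g) z ^ ((-1) ^+ m.+1).

(* In degree 0 the general formula gives c(x) / c(g.x). The reciprocal
   normalization c(g.x) / c(x) below has the same kernel and image, but with it
   the homotopy identity fails in degree 1: the left-hand side becomes
   c(g; x) * (c(rho(g.x); g.x) / c(rho(x); x)) ^ 2. *)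
Definition cobd0 (c : pfun 0) : pfun 1 := fun g z =>
  at_act c (g ord0) (omit_last g) z / c (omit_last g) z.

Lemma cobd_deg0 (c : pfun 0) g z : cobd c g z = (cobd0 c g z)^-1.
Proof.
rewrite /cobd /cobd0 big_ord0 mulr1 invfM invrK mulrC expr1 exprN1.
have -> : omit_first g = omit_last g by apply/funext => -[].
by have -> : ord_max = ord0 :> 'I_1 by apply: val_inj.
Qed.

Definition hmtp m (c : pfun m.+1) : pfun m := fun g z =>
  let k := (\prod_(i < m) g i)%g in
  if `[< act_def k z /\ frame_def (act k z) >]
  then c (prepend (rho (act k z)) g) z else 0.

End Action.

Arguments cochain {R n m} c.
Arguments cobd {R n m} c g z.
Arguments hmtp {R n m} c g z.

(* Main.v *)
Require Import Defs.
From mathcomp Require Import all_boot all_order all_algebra.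
From mathcomp Require Import reals.
From mathcomp Require Import boolp classical_sets derive normedtype realfun ring.
Set Implicit Arguments.
Unset Strict Implicit.
Unset Printing Implicit Defensive.
Import GRing.Theory numFieldNormedType.Exports.
Local Open Scope ring_scope.

(** The identity is the standard contraction of a bar complex by an equivariant
    section. Put [k = g_0 ... g_m] and [r = rho (k x)]. Evaluated at [x],
    [hmtp (cobd c) g] is the coboundary of [c] at the longer simplex
    [(r, g_0, .., g_m)], and each of its factors other than [c g x] is inverse
    to a factor of [cobd (hmtp c) g x]:

    - the contraction of [g_i] with [g_i.+1] commutes with prepending [r] and
      shifts the sign exponent by one ([contractS_prepend]); the frame element
      does not change, since contraction preserves the product [k]
      ([prod_contract]);
    - dropping [g_m] while moving [x] to [g_m x] also commutes with prepending
      [r], because [g_0 ... g_m.-1] sends [g_m x] to [k x] ([act_mul]);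
    - contracting [r] with [g_0] gives [(r g_0, g_1, .., g_m)], to be compared
      with [(rho (g_1 ... g_m x), g_1, .., g_m)]: these agree by equivariance of
      the frame, [rho (g z) g = rho z] ([rho_act]).

    So the algebra is a telescoping, and the geometric content is that the
    prolonged action is an action, and that the frame is equivariant.

    The first is multiplicativity of the homogeneous denominator ([pden_mul])
    together with the chain rule for projective maps ([proj_jacobian_mul]).

    The second says that the normalizing element is unique: if [g] and [h] both
    carry [z] into the cross-section, then [h g^-1] maps a point of the
    cross-section into the cross-section, and such a projectivity is trivial
    ([normalized_scalar]): it fixes three points of the plane, and one covector
    over the first, which are eight conditions in a group of dimension eight.

    The action and the frame are partial, and non-vanishing of
    [cobd (hmtp c) g x] is what makes every step legitimate: it forces each
    factor to be nonzero, hence every action and every frame involved to be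
    defined ([cobd_neq0], [at_act_neq0], [hmtp_neq0]). *)

(** * Projective maps of the plane *)

Section ProjectiveMap.
Variable R : realType.
Implicit Types (A B : 'M[R]_3) (x y p q : R).

(** Treating the three homogeneous coordinates uniformly lets one computation
    serve for both affine coordinates and for the denominator: [proj A 0],
    [proj A 1] and [lin A 2] are convertible to [projx A], [projy A] and
    [pden A]. *)
Definition lin A (i : 'I_3) x y := A i 0 * x + A i 1 * y + A i 2.
Definition proj A (i : 'I_3) x y := lin A i x y / pden A x y.

Lemma sum_ord3 (F : 'I_3 -> R) : \sum_i F i = F 0 + F 1 + F 2.
Proof.
rewrite !big_ord_recl big_ord0 addr0 addrA.
by congr (F _ + F _ + F _); apply: val_inj.
Qed.

Lemma sum_ord2 (F : 'I_2 -> R) : \sum_i F i = F 0 + F 1.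
Proof.
rewrite !big_ord_recl big_ord0 addr0.
by congr (F _ + F _); apply: val_inj.
Qed.

(** In homogeneous coordinates, [B (x, y, 1)] is [pden B x y] times the lift
    [(x', y', 1)] of the image point, and matrices act linearly. *)
Lemma lin_mul A B i x y : pden B x y != 0 ->
  lin (A *m B) i x y = lin A i (projx B x y) (projy B x y) * pden B x y.
Proof.
move=> B0; set u := projx B x y; set v := projy B x y.
have uE : u * pden B x y = lin B 0 x y by rewrite /u /projx divfK.
have vE : v * pden B x y = lin B 1 x y by rewrite /v /projy divfK.
transitivity (A i 0 * (u * pden B x y) + A i 1 * (v * pden B x y)
              + A i 2 * pden B x y); last by rewrite /lin; ring.
by rewrite uE vE /pden /lin !mxE !sum_ord3; ring.
Qed.

Lemma pden_mul A B x y : pden B x y != 0 ->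
  pden (A *m B) x y = pden A (projx B x y) (projy B x y) * pden B x y.
Proof. exact: lin_mul. Qed.

Lemma proj_mul A B i x y : pden B x y != 0 ->
  proj (A *m B) i x y = proj A i (projx B x y) (projy B x y).
Proof. by move=> B0; rewrite /proj pden_mul // lin_mul // -mulf_div divff ?mulr1. Qed.

Lemma lin_scale k A i x y : lin (k *: A) i x y = k * lin A i x y.
Proof. by rewrite /lin !mxE; ring. Qed.

Lemma pden_scale k A x y : pden (k *: A) x y = k * pden A x y.
Proof. exact: lin_scale. Qed.

Lemma proj_scale k A i : k != 0 -> proj (k *: A) i = proj A i.
Proof.
move=> k0; apply/funext => x; apply/funext => y.
by rewrite /proj lin_scale pden_scale -mulf_div divff ?mul1r.
Qed.

Lemma projx_scale k A : k != 0 -> projx (k *: A) = projx A.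
Proof. exact (@proj_scale k A 0). Qed.

Lemma projy_scale k A : k != 0 -> projy (k *: A) = projy A.
Proof. exact (@proj_scale k A 1). Qed.

Lemma projx_mul A B x y : pden B x y != 0 ->
  projx (A *m B) x y = projx A (projx B x y) (projy B x y).
Proof. exact (@proj_mul A B 0 x y). Qed.

Lemma projy_mul A B x y : pden B x y != 0 ->
  projy (A *m B) x y = projy A (projx B x y) (projy B x y).
Proof. exact (@proj_mul A B 1 x y). Qed.

Lemma is_derive_affine (a b t : R) : is_derive t 1 (fun s : R => a * s + b) a.
Proof.
have H := is_deriveD (is_deriveZ a (is_derive_id t (1 : R)))
  (is_derive_cst (b : R) t 1).
apply: is_derive_eq H _.
by rewrite addr0 [LHS]mulr1.
Qed.

Lemma derive1_homography (a b c d t : R) : c * t + d != 0 ->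
  derive1 (fun s => (a * s + b) / (c * s + d)) t
  = (a - (a * t + b) / (c * t + d) * c) / (c * t + d).
Proof.
move=> D0; rewrite derive1E.
have [_ /=] := is_deriveM (is_derive_affine a b t)
  (@is_deriveV R (fun s => c * s + d) t c 1 D0 (is_derive_affine c d t)).
by rewrite /GRing.scale /= => ->; field.
Qed.

Local Notation up := (lift (ord_max : 'I_3)).

Lemma up0 : up 0 = 0.
Proof. exact: val_inj. Qed.

Lemma up1 : up 1 = 1.
Proof. exact: val_inj. Qed.

Lemma ord2_cases (i : 'I_2) : i = 0 \/ i = 1.
Proof. by case: i => -[|[|//]] ?; [left | right]; apply: val_inj. Qed.

(** With [f] the image point and [w] the denominator, the quotient rule gives
    [(A i j - f i * A 2 j) / w]: dividing by [w] once, and keeping [f] instead of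
    the numerator, is the form in which the chain rule becomes linear algebra. *)
Lemma proj_jacobianE A x y : pden A x y != 0 ->
  proj_jacobian A x y =
  \matrix_(i, j) ((A (up i) (up j) - proj A (up i) x y * A 2 (up j)) / pden A x y).
Proof.
move=> A0.
have Jx i : derive1 (fun t => proj A i t y) x
    = (A i 0 - proj A i x y * A 2 0) / pden A x y.
  rewrite /proj /pden /lin.
  under eq_fun do rewrite -!addrA.
  by rewrite derive1_homography !addrA.
have Jy i : derive1 (fun t => proj A i x t) y
    = (A i 1 - proj A i x y * A 2 1) / pden A x y.
  rewrite /proj /pden /lin.
  under eq_fun do rewrite !(addrC (_ * x)) -!addrA.
  by rewrite derive1_homography !addrA !(addrC (_ * y)).
apply/matrixP => i j; rewrite !mxE.
have [-> | ->] := ord2_cases i; have [-> | ->] := ord2_cases j;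
  rewrite /= ?up0 ?up1; [exact: Jx | exact: Jy | exact: Jx | exact: Jy].
Qed.

(** Row [i] of [A] minus [f i] times row 2 is orthogonal to the lift [(u, v, 1)]
    of the intermediate point. This eliminates the third summand of the matrix
    product [A *m B], leaving the product of the two Jacobians. *)
Lemma proj_jacobian_mul A B x y (u := projx B x y) (v := projy B x y) :
  pden B x y != 0 -> pden A u v != 0 ->
  proj_jacobian (A *m B) x y = proj_jacobian A u v *m proj_jacobian B x y.
Proof.
move=> B0 A0; have AB0 : pden (A *m B) x y != 0 by rewrite pden_mul // mulf_neq0.
rewrite !proj_jacobianE //; apply/matrixP => i j; rewrite !mxE.
rewrite sum_ord2 !mxE !sum_ord3 up0 up1 pden_mul // proj_mul // -/u -/v.
move: (up i) (up j) => {}i {}j.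
have -> : proj B 0 x y = u by [].
have -> : proj B 1 x y = v by [].
(* Eliminating the last column of A by the orthogonality relation leaves an
   identity of rational functions in free variables. *)
set f := proj A i u v; set P := pden A u v.
have fE : A i 2 = f * P - A i 0 * u - A i 1 * v.
  by rewrite /f divfK // /lin; ring.
have PE : A 2 2 = P - A 2 0 * u - A 2 1 * v by rewrite /P /pden; ring.
rewrite fE PE; field.
by rewrite B0 A0.
Qed.

Lemma pden1 x y : pden 1%:M x y = 1.
Proof. by rewrite /pden !mxE /=; ring. Qed.

Lemma projx1 x y : projx 1%:M x y = x.
Proof. by rewrite /projx pden1 !mxE /=; field. Qed.

Lemma projy1 x y : projy 1%:M x y = y.
Proof. by rewrite /projy pden1 !mxE /=; field. Qed.

Lemma proj_jacobian1 x y : proj_jacobian 1%:M x y = 1%:M.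
Proof.
rewrite proj_jacobianE ?pden1 ?oner_neq0 //; apply/matrixP => i j.
have j2 : (2 == up j) = false by case: j => -[|[|//]].
by rewrite !mxE j2 mulr0 subr0 divr1 (inj_eq (@lift_inj _ _)).
Qed.

Lemma pden_inv A x y : A \in unitmx -> pden A x y != 0 ->
  pden (invmx A) (projx A x y) (projy A x y) != 0.
Proof.
move=> Au A0; apply: contra_neq (oner_neq0 R) => E.
by rewrite -(pden1 x y) -(mulVmx Au) pden_mul // E mul0r.
Qed.

(** By the chain rule, the Jacobian of the inverse map is a left inverse, so no
    determinant has to be computed. *)
Lemma proj_jacobian_unit A x y : A \in unitmx -> pden A x y != 0 ->
  proj_jacobian A x y \in unitmx.
Proof.
move=> Au A0; pose J' := proj_jacobian (invmx A) (projx A x y) (projy A x y).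
apply: (proj2 (@mulmx1_unit _ _ J' _ _)).
by rewrite -proj_jacobian_mul ?pden_inv // mulVmx // proj_jacobian1.
Qed.

Lemma invmx_mul n (A B : 'M[R]_n.+1) : A \in unitmx -> B \in unitmx ->
  invmx (A *m B) = invmx B *m invmx A.
Proof. by move=> Au Bu; exact: (@invrM 'M[R]_n.+1). Qed.

Lemma row_pairE (r : 'rV[R]_2) : \row_j (if j == 0 then r 0 0 else r 0 1) = r.
Proof.
apply/rowP => j; rewrite mxE; case: j => -[|[|//]] jlt /=; congr (r _ _); exact: val_inj.
Qed.

Lemma prolong_mul A B x y p q (u := projx B x y) (v := projy B x y)
    (r := prolong B x y p q) :
    A \in unitmx -> B \in unitmx -> pden B x y != 0 -> pden A u v != 0 ->
  prolong (A *m B) x y p q = prolong A u v (r 0 0) (r 0 1).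
Proof.
move=> Au Bu B0 A0; rewrite {2}/prolong row_pairE /r /prolong.
by rewrite proj_jacobian_mul // invmx_mul ?proj_jacobian_unit // mulmxA.
Qed.

Lemma prolong1 x y p q : prolong 1%:M x y p q = \row_j (if j == 0 then p else q).
Proof. by rewrite /prolong proj_jacobian1 invmx1 mulmx1. Qed.

Lemma prolong_scale k A : k != 0 -> prolong (k *: A) = prolong A.
Proof.
move=> k0; rewrite /prolong /proj_jacobian.
by rewrite projx_scale // projy_scale.
Qed.

(** The projectivity fixes the points [(1, 0)], [(0, 0)] and [(0, 1)], hence is
    [((c + a) x / w, (c + b) y / w)] with [w = a x + b y + c]; preserving the
    covector [(1, 0)] at [(1, 0)] then says that the first row of the Jacobian
    there is [(1, 0)], which forces [a = b = 0]. *)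
Lemma normalized_scalar A :
    A \in unitmx -> pden A 1 0 != 0 -> pden A 0 0 != 0 -> pden A 0 1 != 0 ->
    projx A 1 0 = 1 -> projy A 1 0 = 0 ->
    prolong A 1 0 1 0 0 0 = 1 -> prolong A 1 0 1 0 0 1 = 0 ->
    projx A 0 0 = 0 -> projy A 0 0 = 0 ->
    projx A 0 1 = 0 -> projy A 0 1 = 1 ->
  A = (A 2 2) *: 1%:M.
Proof.
move=> Au D0 D1 D2 x0 y0 p0 q0 x1 y1 x2 y2.
have linE i x y v : pden A x y != 0 -> proj A i x y = v ->
  lin A i x y = v * pden A x y by move=> D <-; rewrite divfK.
have := linE 0 _ _ _ D1 x1; have := linE 1 _ _ _ D1 y1.
rewrite /lin !(mulr0, mul0r, addr0, add0r) => A12 A02.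
have := linE 0 _ _ _ D2 x2; have := linE 1 _ _ _ D2 y2.
have := linE 0 _ _ _ D0 x0; have := linE 1 _ _ _ D0 y0.
rewrite /lin /pden A02 A12 !(mulr0, mulr1, mul0r, mul1r, addr0, add0r).
move=> A10 A00 A11 A01.
(* Multiplying the prolonged covector by the Jacobian undoes the inverse. *)
have /rowP J : prolong A 1 0 1 0 *m proj_jacobian A 1 0 =
    \row_j (if j == 0 then 1 else 0) by rewrite mulmxKV ?proj_jacobian_unit.
have := J 0; have := J 1.
rewrite proj_jacobianE // !mxE !sum_ord2 p0 q0 !mxE /= !(mul0r, mul1r, addr0).
rewrite up0 up1.
have -> : proj A 0 1 0 = 1 by [].
rewrite A01 !mul1r sub0r => /eqP; rewrite mulf_eq0 invr_eq0 (negbTE D0) orbF oppr_eq0.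
move=> /eqP A21 /(canRL (divfK D0)).
rewrite mul1r A00 /pden A21 mulr1 mulr0 addr0 addrAC subrr add0r => A22.
have A20 : A 2 0 = 0.
  by apply: (addIr (A 2 2)); rewrite add0r.
move: A00 A11; rewrite A20 A21 !add0r => A00 A11.
apply/matrixP => i j; rewrite !mxE.
case: i => -[|[|[|//]]] ilt; case: j => -[|[|[|//]]] jlt; rewrite ?mulr1 ?mulr0.
all: match goal with |- _ (@Ordinal _ ?a _) (@Ordinal _ ?b _) = _ =>
  rewrite (_ : Ordinal ilt = a%:R) 1?(_ : Ordinal jlt = b%:R) //; try exact: val_inj end.
Qed.

End ProjectiveMap.

(** * The prolonged action *)

Section Action.
Variables (R : realType) (n : nat).
Implicit Types (g h : PGL3 R) (z : jet R n).

(** The action of a representing matrix. An element of the quotient acts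
    through an uncontrolled representative, which for a product is only a
    multiple of the product of the representatives; the lemmas are therefore
    proved for matrices, where multiplication is explicit, and transferred by
    [act_pgl3]. *)
Definition mxact_def (A : 'M[R]_3) z := forall i, pden A (jx z i) (jy z i) != 0.

Definition mxact (A : 'M[R]_3) z : jet R n :=
  \matrix_(i, j)
    let x := jx z i in let y := jy z i in
    let p := jp z i in let q := jq z i in
    if j == 0 then projx A x y
    else if j == 1 then projy A x y
    else if j == 2 then prolong A x y p q 0 0
    else prolong A x y p q 0 1.

Lemma jet_coords z z' : (forall i, [/\ jx z i = jx z' i, jy z i = jy z' i,
  jp z i = jp z' i & jq z i = jq z' i]) -> z = z'.
Proof.
move=> E; apply/matrixP => i j; have [] := E i.
rewrite /jx /jy /jp /jq => e0 e1 e2 e3.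
case: j => -[|[|[|[|//]]]] jlt.
- by have -> : Ordinal jlt = 0 by exact: val_inj.
- by have -> : Ordinal jlt = 1 by exact: val_inj.
- by have -> : Ordinal jlt = 2 by exact: val_inj.
- by have -> : Ordinal jlt = 3 by exact: val_inj.
Qed.

Lemma jx_mxact A z i : jx (mxact A z) i = projx A (jx z i) (jy z i).
Proof. by rewrite /jx mxE. Qed.
Lemma jy_mxact A z i : jy (mxact A z) i = projy A (jx z i) (jy z i).
Proof. by rewrite /jy mxE. Qed.
Lemma jp_mxact A z i :
  jp (mxact A z) i = prolong A (jx z i) (jy z i) (jp z i) (jq z i) 0 0.
Proof. by rewrite /jp mxE. Qed.
Lemma jq_mxact A z i :
  jq (mxact A z) i = prolong A (jx z i) (jy z i) (jp z i) (jq z i) 0 1.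
Proof. by rewrite /jq mxE. Qed.
Definition jet_mxact := (jx_mxact, jy_mxact, jp_mxact, jq_mxact).

Lemma mxact_scale k (A : 'M[R]_3) z : k != 0 -> mxact (k *: A) z = mxact A z.
Proof.
(* Replacing the scaled matrix by a variable keeps unification from comparing
   the two actions entry by entry. *)
move=> k0; move: (prolong_scale A k0) (projx_scale A k0) (projy_scale A k0).
by move: (k *: A) => B pE xE yE; rewrite /mxact pE xE yE.
Qed.

Lemma mxact_def_scale k (A : 'M[R]_3) z : k != 0 ->
  mxact_def (k *: A) z <-> mxact_def A z.
Proof.
move=> k0; split=> D i; move: (D i); rewrite pden_scale mulf_eq0 (negbTE k0) //.
Qed.

Lemma act_pgl3 (A : GL3 R) z : act (pgl3 A) z = mxact (val A) z.
Proof. by have [k k0 E] := repr_pgl3 A; rewrite -(mxact_scale (val A) z k0) -E. Qed.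

Lemma act_def_pgl3 (A : GL3 R) z : act_def (pgl3 A) z <-> mxact_def (val A) z.
Proof.
have [k k0 E] := repr_pgl3 A; apply: iff_trans (mxact_def_scale (val A) z k0).
by rewrite -E.
Qed.

(** The equivalence is used from left to right as well: if [h] and [g * h] are
    defined at [z], then [g] is defined at [act h z]. *)
Lemma act_def_mul g h z : act_def h z ->
  act_def (g * h)%g z <-> act_def g (act h z).
Proof.
move=> Dh; apply: (iff_trans (act_def_pgl3 _ z)); split=> D i; move: (D i) (Dh i).
  rewrite /= => + Dhi; rewrite pden_mul // mulf_eq0 negb_or => /andP[+ _].
  by rewrite jx_mxact jy_mxact.
by rewrite jx_mxact jy_mxact => Dgi Dhi; rewrite pden_mul // mulf_neq0.
Qed.

Lemma mxact_mul (A B : 'M[R]_3) z : A \in unitmx -> B \in unitmx ->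
    mxact_def B z -> mxact_def A (mxact B z) ->
  mxact (A *m B) z = mxact A (mxact B z).
Proof.
move=> Au Bu DB DA.
have xE i := projx_mul A (DB i); have yE i := projy_mul A (DB i).
have pE i := prolong_mul (jp z i) (jq z i) Au Bu (DB i).
(* The product is replaced by a variable for the same reason as the scaled
   matrix in mxact_scale. *)
move: (A *m B) xE yE pE => C xE yE pE.
apply/matrixP => i j; rewrite [LHS]mxE [RHS]mxE /=.
move: (DA i) (xE i) (yE i) (pE i); rewrite jp_mxact jq_mxact jx_mxact jy_mxact.
by move=> DAi -> -> ->.
Qed.

Lemma act_mul g h z : act_def h z -> act_def g (act h z) ->
  act (g * h)%g z = act g (act h z).
Proof.
move=> Dh Dg; rewrite (act_pgl3 (gl3_mul (repr g) (repr h))).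
exact: (mxact_mul (valP (repr g)) (valP (repr h)) Dh Dg).
Qed.

Lemma act_def1 z : act_def 1%g z.
Proof. by apply/act_def_pgl3 => i /=; rewrite pden1 oner_neq0. Qed.

Lemma act1 z : act 1%g z = z.
Proof.
rewrite (act_pgl3 (gl3_one R)); apply: jet_coords => i.
by rewrite !jet_mxact /= projx1 projy1 prolong1 !mxE.
Qed.

Lemma act_def_inv g z : act_def g z -> act_def g^-1%g (act g z).
Proof. by move=> D; apply/(act_def_mul _ D); rewrite mulVg; exact: act_def1. Qed.

Lemma act_inv g z : act_def g z -> act g^-1%g (act g z) = z.
Proof. by move=> D; rewrite -(act_mul D (act_def_inv D)) mulVg act1. Qed.

End Action.

(** * The moving frame *)

Section Frame.
Variables (R : realType) (n : nat) (hn : (3 <= n)%N).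
Implicit Types (g h : PGL3 R) (z : jet R n).

(** Freeness of the action on the cross-section, and hence uniqueness of the
    moving frame; the three jets it constrains are there because [3 <= n]. *)
Lemma cross_section_free g z : act_def g z ->
  cross_section z -> cross_section (act g z) -> g = 1%g.
Proof.
move=> D K gK.
have [lt0 lt1] : (0 < n)%N /\ (1 < n)%N by split; apply: leq_trans hn.
pose i0 := Ordinal lt0; pose i1 := Ordinal lt1; pose i2 := Ordinal hn.
have [/(_ erefl) [x0 y0 p0 q0] _ _] := K i0.
have [_ /(_ erefl) [x1 y1] _] := K i1.
have [_ _ /(_ erefl) [x2 y2]] := K i2.
have [/(_ erefl) + _ _] := gK i0.
have [_ /(_ erefl) + _] := gK i1.
have [_ _ /(_ erefl)] := gK i2.
move: (D i0) (D i1) (D i2).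
rewrite !jet_mxact x0 y0 p0 q0 x1 y1 x2 y2.
move=> D0 D1 D2 [gx2 gy2] [gx1 gy1] [gx0 gy0 gp0 gq0].
have gE := normalized_scalar (valP (repr g)) D0 D1 D2 gx0 gy0 gp0 gq0 gx1 gy1 gx2 gy2.
rewrite -[g]reprK; apply/(pgl3_eqP (repr g) (gl3_one R)).
exists (val (repr g) 2 2) => //.
by move: D1; rewrite /pden !mulr0 !add0r.
Qed.

Lemma normalizes_act g h z : act_def g z -> normalizes z h ->
  normalizes (act g z) (h * g^-1)%g.
Proof.
move=> Dg [Dh Kh]; have Dg' := act_def_inv Dg.
have Dh' : act_def h (act g^-1%g (act g z)) by rewrite (act_inv Dg).
split; first exact: (proj2 (act_def_mul _ Dg') Dh').
by rewrite (act_mul Dg' Dh') (act_inv Dg).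
Qed.

(** [h g^-1] carries the point [act g z] of the cross-section into the
    cross-section. *)
Lemma normalizes_inj g h z : normalizes z g -> normalizes z h -> g = h.
Proof.
move=> [Dg Kg] /(normalizes_act Dg) [D K].
by rewrite -[h](mulgVK g) (cross_section_free D Kg K) mul1g.
Qed.

Lemma rho_normalizes z : frame_def z -> normalizes z (rho z).
Proof. by move=> Fz; exact: (xgetPex 1%g Fz). Qed.

(** Equivariance [rho (g z) = rho z * g^-1], in the form used for the face of
    the simplex where [rho (g z)] is contracted with [g]. *)
Lemma rho_act g z : act_def g z -> frame_def z -> (rho (act g z) * g)%g = rho z.
Proof.
move=> Dg /rho_normalizes /(normalizes_act Dg) N.
have Fg : frame_def (act g z) by exists (rho z * g^-1)%g.
by rewrite (normalizes_inj (rho_normalizes Fg) N) mulgVK.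
Qed.

End Frame.

(** * Faces of a simplex with a prepended vertex *)

Section Simplices.
Variable R : realType.

Lemma prepend0 m (r : PGL3 R) (g : 'I_m -> PGL3 R) : prepend r g ord0 = r.
Proof. by rewrite /prepend unlift_none. Qed.

Lemma prependS m (r : PGL3 R) (g : 'I_m -> PGL3 R) i :
  prepend r g (lift ord0 i) = g i.
Proof. by rewrite /prepend liftK. Qed.

Lemma omit_first_prepend m (r : PGL3 R) (g : 'I_m -> PGL3 R) :
  omit_first (prepend r g) = g.
Proof. by apply/funext => i; exact: prependS. Qed.

(** Equalities of sequences below are proved by splitting off the first entry. *)
Lemma prepend_eta m (f : 'I_m.+1 -> PGL3 R) :
  prepend (f ord0) (omit_first f) = f.
Proof. by apply/funext => i; rewrite /prepend; case: unliftP => [j|] ->. Qed.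

Lemma prod_prepend m (r : PGL3 R) (g : 'I_m -> PGL3 R) :
  (\prod_(i < m.+1) prepend r g i = r * \prod_(i < m) g i)%g.
Proof.
by rewrite big_ord_recl prepend0; under eq_bigr do rewrite prependS.
Qed.

Lemma lift_max0 m : lift ord_max ord0 = ord0 :> 'I_m.+2.
Proof. exact: val_inj. Qed.

Lemma lift_maxS m (i : 'I_m) :
  lift ord_max (lift ord0 i) = lift ord0 (lift ord_max i) :> 'I_m.+2.
Proof. by apply: val_inj; rewrite /= /bump /= !add1n ltnS addnS. Qed.

Lemma omit_last_prepend m (r : PGL3 R) (g : 'I_m.+1 -> PGL3 R) :
  omit_last (prepend r g) = prepend r (omit_last g).
Proof.
rewrite -[LHS]prepend_eta; congr prepend.
  by rewrite /omit_last lift_max0 prepend0.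
by apply/funext => i; rewrite /omit_first /omit_last lift_maxS prependS.
Qed.

Lemma prepend_last m (r : PGL3 R) (g : 'I_m.+1 -> PGL3 R) :
  prepend r g ord_max = g ord_max.
Proof.
by have -> : ord_max = lift ord0 ord_max :> 'I_m.+2; [exact: val_inj | exact: prependS].
Qed.

Lemma contract0_prepend m (r : PGL3 R) (g : 'I_m.+1 -> PGL3 R) :
  contract ord0 (prepend r g) = prepend (r * g ord0)%g (omit_first g).
Proof.
rewrite -[LHS]prepend_eta; congr prepend.
  by rewrite /contract /= lift_max0 prepend0 prependS.
by apply/funext => i; rewrite /omit_first /contract /= prependS.
Qed.

Lemma contractS_prepend m (r : PGL3 R) (i : 'I_m) (g : 'I_m.+1 -> PGL3 R) :
  contract (lift ord0 i) (prepend r g) = prepend r (contract i g).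
Proof.
rewrite -[LHS]prepend_eta; congr prepend.
  by rewrite /contract /= lift_max0 prepend0.
apply/funext => j; rewrite /omit_first /contract lift_maxS.
by rewrite !prependS (inj_eq (@lift_inj _ _)) /= /bump /= !add1n ltnS.
Qed.

Lemma prod_contract m (i : 'I_m) (g : 'I_m.+1 -> PGL3 R) :
  (\prod_(j < m) contract i g j = \prod_(j < m.+1) g j)%g.
Proof.
elim: m i g => [[] // | m IH] i g; rewrite -(prepend_eta g) prod_prepend.
case: (unliftP ord0 i) => [j|] ->; first by rewrite contractS_prepend prod_prepend IH.
by rewrite contract0_prepend prod_prepend -[in RHS](prepend_eta (omit_first g))
  prod_prepend mulgA.
Qed.

End Simplices.

(** * The homotopy identity *)

Section Homotopy.
Variables (R : realType) (n : nat).
Implicit Types (x : jet R n).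

Lemma hmtpE m (c : pfun R n m.+1) (g : 'I_m -> PGL3 R) x
    (k := (\prod_(i < m) g i)%g) :
    act_def k x -> frame_def (act k x) ->
  hmtp c g x = c (prepend (rho (act k x)) g) x.
Proof. by move=> D F; rewrite /hmtp asboolT. Qed.

Lemma hmtp_neq0 m (c : pfun R n m.+1) (g : 'I_m -> PGL3 R) x
    (k := (\prod_(i < m) g i)%g) :
  hmtp c g x != 0 -> act_def k x /\ frame_def (act k x).
Proof. by rewrite /hmtp; case: asboolP => // _; rewrite eqxx. Qed.

Lemma at_actE m (c : pfun R n m) h (g : 'I_m -> PGL3 R) x :
  act_def h x -> at_act c h g x = c g (act h x).
Proof. by move=> D; rewrite /at_act asboolT. Qed.

Lemma at_act_neq0 m (c : pfun R n m) h (g : 'I_m -> PGL3 R) x :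
  at_act c h g x != 0 -> act_def h x /\ c g (act h x) != 0.
Proof. by rewrite /at_act; case: asboolP => // _; rewrite eqxx. Qed.

Lemma sign_exp_neq0 (a : R) k : a ^ ((-1) ^+ k) != 0 -> a != 0.
Proof. by rewrite expfz_eq0 signr_eq0. Qed.

(** Prepending an entry raises the index of a face by one, so matching factors
    occur with opposite exponents. *)
Lemma sign_expK (a : R) k : a != 0 -> a ^ ((-1) ^+ k) * a ^ ((-1) ^+ k.+1) = 1.
Proof. by move=> a0; rewrite -expfzDr // exprS mulN1r subrr. Qed.

Lemma cobd_neq0 m (c : pfun R n m) (g : 'I_m.+1 -> PGL3 R) x :
  cobd c g x != 0 -> [/\ c (omit_first g) x != 0,
    forall i : 'I_m, c (contract i g) x != 0 &
    at_act c (g ord_max) (omit_last g) x != 0].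
Proof.
rewrite /cobd !mulf_eq0 !negb_or => /andP[/andP[c0 /prodf_neq0 ci] cl].
by split=> // [i|]; [apply: (@sign_exp_neq0 _ i.+1); exact: ci
                    | exact: sign_exp_neq0 cl].
Qed.

End Homotopy.

Theorem theorem7 (R : realType) (n : nat) (hn : (3 <= n)%N) (m : nat)
    (c : pfun R n m.+1) (hc : cochain c)
    (g : 'I_m.+1 -> PGL3 R) (x : jet R n)
    (hdef : cobd (hmtp c) g x != 0) :
  cobd (hmtp c) g x * hmtp (cobd c) g x = c g x.
Proof.
have [c0 ci /[dup] cl /at_act_neq0 [Dl cl']] := cobd_neq0 hdef.
pose k := (\prod_(i < m.+1) g i)%g; pose r := rho (act k x).
have kl : k = (\prod_(i < m) omit_last g i * g ord_max)%g.
  rewrite /k big_ord_recr; congr (_ * _)%g; apply: eq_bigr => i _.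
  by congr (g _); apply: val_inj; rewrite [RHS]lift_max.
have kf : k = (g ord0 * \prod_(i < m) omit_first g i)%g by rewrite /k big_ord_recl.
have [D1 F1] := hmtp_neq0 c0.
have [D2 F2] := hmtp_neq0 cl'.
have Dk : act_def k x by rewrite kl; exact: (proj2 (act_def_mul _ Dl) D2).
have Fk : frame_def (act k x) by rewrite kl (act_mul Dl D2).
(* The only place where equivariance of the frame enters. *)
have E0 : hmtp c (omit_first g) x = c (contract ord0 (prepend r g)) x.
  have D0 : act_def (g ord0) (act (\prod_(i < m) omit_first g i)%g x).
    by apply: (proj1 (act_def_mul _ D1)); rewrite -kf.
  by rewrite contract0_prepend (hmtpE c D1 F1) /r kf (act_mul D1 D0) (rho_act hn D0 F1).
have Ei i : hmtp c (contract i g) x = c (contract (lift ord0 i) (prepend r g)) x.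
  by rewrite contractS_prepend hmtpE ?prod_contract.
have El : at_act (hmtp c) (g ord_max) (omit_last g) x
    = at_act c (g ord_max) (prepend r (omit_last g)) x.
  have rE : rho (act (\prod_(i < m) omit_last g i)%g (act (g ord_max) x)) = r.
    by rewrite /r kl (act_mul Dl D2).
  by rewrite (at_actE (hmtp c) _ Dl) (at_actE c _ Dl) (hmtpE c D2 F2) rE.
(* Each factor of the second coboundary except c g x is now a factor of the
   first one with the opposite exponent. *)
rewrite [hmtp (cobd c) g x](hmtpE _ Dk Fk) -/k -/r /cobd.
rewrite omit_first_prepend omit_last_prepend prepend_last big_ord_recl -El -E0.
set F := hmtp c (omit_first g) x; set T := at_act _ _ _ _.
set P := \prod_(i < m) _; set Q := \prod_(i < m) _.
have PQ : P * Q = 1.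
  rewrite /P /Q -big_split; apply: big1 => i _.
  by rewrite lift0 -(Ei i); exact: sign_expK (ci i).
have TT := sign_expK m.+1 cl.
have FF := sign_expK 0 c0.
move: FF TT PQ; rewrite -/F -/T expr0 expr1z /=.
move: (F ^ _) (T ^ _) (T ^ _) => F' T2 T1 FF TT PQ.
transitivity (F * F' * (P * Q) * (T1 * T2) * c g x); first by ring.
by rewrite FF PQ TT !mul1r.
Qed.
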